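(* Let $A$ be a ring, let $\mathfrak{C}$ be an $A$-coring with ${}_A\mathfrak{C}$ flat, and let $\Sigma$ be a right $\mathfrak{C}$-comodule that is finitely generated and projective as a right $A$-module. Assume that $\Sigma$ is quasi-projective in the category $\mathcal{M}^{\mathfrak{C}}$ of right $\mathfrak{C}$-comodules and generates every subcomodule of any finite direct sum of copies of $\Sigma$ (for example, $\Sigma$ is a semisimple comodule). If the canonical map $\mathsf{can}:\Sigma^*\otimes_T\Sigma\to\mathfrak{C}$, $T=\mathrm{End}_{\mathfrak{C}}(\Sigma)$, is surjective, then $(\mathfrak{C},\Sigma)$ is Galois.
   Context: All rings are associative unital algebras over a fixed commutative ring $K$, and bimodules are centralized by $K$. An $A$-coring is an $A$-bimodule $\mathfrak{C}$ with $A$-bimodule maps $\Delta:\mathfrak{C}\to\mathfrak{C}\otimes_A\mathfrak{C}$ and $\epsilon:\mathfrak{C}\to A$ that are coassociative and counital. A right $\mathfrak{C}$-comodule is a right $A$-module $M$ with a right $A$-linear coassociative and counital coaction $\rho_M:M\to M\otimes_A\mathfrak{C}$; $\mathrm{Hom}_{\mathfrak{C}}(M,N)$ is the set of right $A$-linear maps commuting with the coactions. If ${}_A\mathfrak{C}$ is flat, $\mathcal{M}^{\mathfrak{C}}$ is a Grothendieck category. Let $\Sigma^*=\mathrm{Hom}_A(\Sigma,A)$ and $T=\mathrm{End}_{\mathfrak{C}}(\Sigma)$ (product is composition). The canonical map is $\mathsf{can}(\phi\otimes_Tx)=\sum\phi(x_0)x_1$, where $\rho_\Sigma(x)=\sum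 x_0\otimes_Ax_1$. The pair $(\mathfrak{C},\Sigma)$ is called Galois if $\mathsf{can}$ is an isomorphism (it is always a homomorphism of $A$-corings for the comatrix coring structure on $\Sigma^*\otimes_T\Sigma$, given by $\Delta(\phi\otimes_Tx)=\sum_i\phi\otimes_Te_i\otimes_Ae_i^*\otimes_Tx$ for a finite dual basis $\{(e_i^*,e_i)\}$ of $\Sigma_A$ and $\epsilon(\phi\otimes_Tx)=\phi(x)$). $\Sigma$ is quasi-projective if for every exact sequence $\Sigma\to N\to0$ in $\mathcal{M}^{\mathfrak{C}}$ the sequence $\mathrm{Hom}_{\mathfrak{C}}(\Sigma,\Sigma)\to\mathrm{Hom}_{\mathfrak{C}}(\Sigma,N)\to0$ is exact. $\Sigma$ generates a comodule $N$ if there is an epimorphism $\Sigma^{(I)}\to N$ in $\mathcal{M}^{\mathfrak{C}}$ for some set $I$. *)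

(* Defs.v *)
From HB Require Import structures.
From mathcomp Require Import all_boot all_order all_algebra.
From mathcomp Require Import finmap monalg boolp.

Set Implicit Arguments.
Unset Strict Implicit.
Unset Printing Implicit Defensive.

Import GRing.Theory.
Local Open Scope ring_scope.

Reserved Notation "x ** a" (at level 40, left associativity).
Reserved Notation "x ⊗ y" (at level 40, left associativity).

(* Left modules are lmodType. The rings are pzRingType rather than            *)
(* nzRingType, because the zero ring is allowed (e.g. as the endomorphism     *)
(* ring of the zero comodule).                                                *)

HB.mixin Record Zmodule_isRmodule (A : pzRingType) V of GRing.Zmodule V := {
  rscale : V -> A -> V;
  rscaleA : forall x a b, rscale (rscale x a) b = rscale x (a * b);
  rscale1 : forall x, rscale x 1 = x;
  rscaleDl : forall x y a, rscale (x + y) a = rscale x a + rscale y a;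
  rscaleDr : forall x a b, rscale x (a + b) = rscale x a + rscale x b
}.
#[short(type="rmodType")]
HB.structure Definition Rmodule (A : pzRingType) :=
  {V of GRing.Zmodule V & Zmodule_isRmodule A V}.

Notation "x ** a" := (rscale x a) : ring_scope.

HB.mixin Record LRmodule_isBimodule (A B : pzRingType) V
    of GRing.Lmodule A V & Rmodule B V := {
  scale_rscale : forall (a : A) (x : V) (b : B), a *: (x ** b) = (a *: x) ** b
}.
#[short(type="bimodType")]
HB.structure Definition Bimodule (A B : pzRingType) :=
  {V of GRing.Lmodule A V & Rmodule B V & LRmodule_isBimodule A B V}.

Definition rlinear (A : pzRingType) (M N : rmodType A) (f : M -> N) : Prop :=
  {morph f : x y / x + y} /\ (forall x a, f (x ** a) = f x ** a).

Definition bimodule_linear (A B : pzRingType) (M N : bimodType A B) (f : M -> N) :=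
  linear f /\ rlinear f.

Definition surjective (X Y : Type) (f : X -> Y) := forall y, exists x, f x = y.

Section Regular.
Variable A : pzRingType.

HB.instance Definition _ := Zmodule_isRmodule.Build A A^o
  (rscale := fun x a : A => x * a)
  (fun x a b : A => esym (mulrA x a b)) (@mulr1 A) (@mulrDl A) (@mulrDr A).
HB.instance Definition _ := LRmodule_isBimodule.Build A A A^o (@mulrA A).

End Regular.

Definition finitely_generated (A : pzRingType) (M : rmodType A) : Prop :=
  exists (n : nat) (e : 'I_n -> M),
    forall x, exists a : 'I_n -> A, x = \sum_i e i ** a i.

Definition projective (A : pzRingType) (P : rmodType A) : Prop :=
  forall (M N : rmodType A) (p : M -> N) (f : P -> N),
    rlinear p -> surjective p -> rlinear f ->
    exists2 g : P -> M, rlinear g & forall x, p (g x) = f x.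

Section Tensor.
Variables (A : pzRingType) (M : rmodType A) (N : lmodType A).

(* M ⊗_A N consists of the finite formal sums of pairs (x, y), encoded as     *)
(* lists, modulo the congruence generated by the bilinear relations. Since    *)
(* (0, y) is identified with the empty sum, (- x, y) is the opposite of       *)
(* (x, y), so the quotient monoid is the usual abelian group.                 *)
Inductive tens_rel : seq (M * N) -> seq (M * N) -> Prop :=
| TensRefl s : tens_rel s s
| TensSym s t : tens_rel s t -> tens_rel t s
| TensTrans s t u : tens_rel s t -> tens_rel t u -> tens_rel s u
| TensCat s s' t t' :
    tens_rel s s' -> tens_rel t t' -> tens_rel (s ++ t) (s' ++ t')
| TensC s t : tens_rel (s ++ t) (t ++ s)
| Tens0 y : tens_rel [:: (0, y)] [::]
| TensDl x x' y : tens_rel [:: (x + x', y)] [:: (x, y); (x', y)]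
| TensDr x y y' : tens_rel [:: (x, y + y')] [:: (x, y); (x, y')]
| TensBal x a y : tens_rel [:: (x ** a, y)] [:: (x, a *: y)].

Definition tens_relb : rel (seq (M * N)) := fun s t => `[< tens_rel s t >].

Lemma tens_relb_equiv : equiv_class_of tens_relb.
Proof.
split=> [s|s t|t s u].
- exact/asboolP/TensRefl.
- by apply/asboolP/asboolP; apply: TensSym.
- by move=> /asboolP st /asboolP tu; apply/asboolP/(TensTrans st tu).
Qed.
Canonical tens_relb_equivRel := EquivRelPack tens_relb_equiv.

Definition tensor := {eq_quot tens_relb}%qT.
HB.instance Definition _ := Choice.on tensor.
HB.instance Definition _ := EqQuotient.on tensor.

Implicit Types u v : tensor.

Definition tens (x : M) (y : N) : tensor := (\pi_tensor [:: (x, y)])%qT.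

Definition tensor_zero : tensor := (\pi_tensor [::])%qT.
Definition tensor_add u v : tensor := (\pi_tensor (repr u ++ repr v))%qT.
Definition tensor_opp u : tensor :=
  (\pi_tensor [seq (- p.1, p.2) | p <- repr u])%qT.

Lemma tensorP s t : ((\pi_tensor s)%qT = (\pi_tensor t)%qT) <-> tens_rel s t.
Proof.
split=> [/eqquotP/asboolP //|st].
by apply/eqquotP/asboolP.
Qed.

Lemma repr_rel s : tens_rel (repr (\pi_tensor s)%qT) s.
Proof. by apply/tensorP; rewrite reprK. Qed.

Lemma tensor_addE s t :
  tensor_add (\pi_tensor s)%qT (\pi_tensor t)%qT = (\pi_tensor (s ++ t))%qT.
Proof. by apply/tensorP/TensCat; apply: repr_rel. Qed.

Lemma tensor_addA : associative tensor_add.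
Proof.
move=> u v w; rewrite -[u]reprK -[v]reprK -[w]reprK.
move: (repr u) (repr v) (repr w) => s t r.
by rewrite (tensor_addE t r) (tensor_addE s (t ++ r)) (tensor_addE s t)
  (tensor_addE (s ++ t) r) catA.
Qed.

Lemma tensor_addC : commutative tensor_add.
Proof.
move=> u v; rewrite -[u]reprK -[v]reprK; move: (repr u) (repr v) => s t.
by rewrite (tensor_addE s t) (tensor_addE t s); apply/tensorP/TensC.
Qed.

Lemma tensor_add0 : left_id tensor_zero tensor_add.
Proof. by move=> u; rewrite -[u]reprK (tensor_addE [::]). Qed.

Lemma tensor_addN : left_inverse tensor_zero tensor_opp tensor_add.
Proof.
move=> u; rewrite -{2}[u]reprK /tensor_opp tensor_addE; apply/tensorP.
elim: (repr u) => [|[x y] s IHs] /=; first exact: TensRefl.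
apply: (@TensTrans _ ([:: (- x, y); (x, y)] ++
          ([seq (- p.1, p.2) | p <- s] ++ s))).
  rewrite /=; apply: (@TensCat [:: _] [:: _]); first exact: TensRefl.
  rewrite -[(x, y) :: s]cat1s -[(x, y) :: (_ ++ s)]cat1s !catA.
  by apply: TensCat; [exact: TensC | exact: TensRefl].
rewrite -[X in tens_rel _ X]cat0s; apply: TensCat => //.
apply: (TensTrans (TensSym (TensDl _ _ _))); rewrite addNr; exact: Tens0.
Qed.

HB.instance Definition _ := GRing.isZmodule.Build tensor
  tensor_addA tensor_addC tensor_add0 tensor_addN.

Local Notation "x ⊗ y" := (tens x y) : ring_scope.

Lemma pi_tensorE s : (\pi_tensor s)%qT = \sum_(p <- s) (p.1 ⊗ p.2) :> tensor.
Proof.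
elim: s => [|[x y] s IHs]; first by rewrite big_nil.
by rewrite big_cons -IHs /= -cat1s -tensor_addE.
Qed.

Lemma tensorE u : u = \sum_(p <- repr u) (p.1 ⊗ p.2).
Proof. by rewrite -pi_tensorE reprK. Qed.

Lemma tensor_ind (P : tensor -> Prop) :
    P 0 -> (forall x y, P (x ⊗ y)) -> (forall u v, P u -> P v -> P (u + v)) ->
  forall u, P u.
Proof.
move=> P0 Pt PD u; rewrite [u]tensorE.
by elim/big_ind: _ => // i _; apply: Pt.
Qed.

Lemma tensDl x x' y : (x + x') ⊗ y = x ⊗ y + x' ⊗ y.
Proof.
by rewrite [RHS](tensor_addE [:: _] [:: _]); apply/tensorP/TensDl.
Qed.

Lemma tensDr x y y' : x ⊗ (y + y') = x ⊗ y + x ⊗ y'.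
Proof.
by rewrite [RHS](tensor_addE [:: _] [:: _]); apply/tensorP/TensDr.
Qed.

Lemma tens_bal x a y : (x ** a) ⊗ y = x ⊗ (a *: y).
Proof. exact/tensorP/TensBal. Qed.

Section Lift.
Variable V : zmodType.

Definition balanced (f : M -> N -> V) : Prop :=
  [/\ forall x x' y, f (x + x') y = f x y + f x' y,
      forall x y y', f x (y + y') = f x y + f x y' &
      forall x a y, f (x ** a) y = f x (a *: y)].

(* The map x ⊗ y |-> f x y; meaningful when f is balanced (tlift_tens).       *)
Definition tlift (f : M -> N -> V) (u : tensor) : V :=
  \sum_(p <- repr u) f p.1 p.2.

Lemma tlift_pi f s : balanced f ->
  tlift f (\pi_tensor s)%qT = \sum_(p <- s) f p.1 p.2.
Proof.
case=> fDl fDr fb; rewrite /tlift.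
move: (repr _) (repr_rel s) => s' rs; elim: rs => // {s s'}.
- by move=> s t u _ -> _ ->.
- by move=> s s' t t' _ IH1 _ IH2; rewrite !big_cat /= IH1 IH2.
- by move=> s t; rewrite !big_cat /= addrC.
- move=> y; rewrite big_seq1 big_nil /=.
  by apply: (addIr (f 0 y)); rewrite -fDl !add0r.
- by move=> x x' y; rewrite big_seq1 big_cons big_seq1 fDl.
- by move=> x y y'; rewrite big_seq1 big_cons big_seq1 fDr.
- by move=> x a y; rewrite !big_seq1 fb.
Qed.

Lemma tlift_tens f x y : balanced f -> tlift f (x ⊗ y) = f x y.
Proof. by move=> fb; rewrite tlift_pi // big_seq1. Qed.

Lemma tliftD f u v : balanced f -> tlift f (u + v) = tlift f u + tlift f v.
Proof. by move=> fb; rewrite [u + v]/(tensor_add u v) tlift_pi // big_cat. Qed.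

Lemma tlift0 f : balanced f -> tlift f 0 = 0.
Proof. by move=> fb; apply: (addIr (tlift f 0)); rewrite -tliftD // !add0r. Qed.

Lemma tensor_ext (f g : tensor -> V) :
    {morph f : u v / u + v} -> {morph g : u v / u + v} ->
    (forall x y, f (x ⊗ y) = g (x ⊗ y)) -> f =1 g.
Proof.
move=> fD gD fg; elim/tensor_ind => // [|u v IHu IHv]; last first.
  by rewrite fD gD IHu IHv.
have E (h : tensor -> V) : {morph h : u v / u + v} -> h 0 = 0.
  by move=> hD; apply: (addIr (h 0)); rewrite -hD !add0r.
by rewrite !E.
Qed.

End Lift.

Lemma tens0l y : 0 ⊗ y = 0.
Proof. by apply: (addIr (0 ⊗ y)); rewrite -tensDl !add0r. Qed.
Lemma tens0r x : x ⊗ 0 = 0.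
Proof. by apply: (addIr (x ⊗ 0)); rewrite -tensDr !add0r. Qed.
Lemma tens_suml I (r : seq I) (F : I -> M) y :
  (\sum_(i <- r) F i) ⊗ y = \sum_(i <- r) (F i ⊗ y).
Proof.
exact: (big_morph (tens^~ y) (fun a b => tensDl a b y) (tens0l y)).
Qed.
Lemma tens_sumr I (r : seq I) (F : I -> N) x :
  x ⊗ (\sum_(i <- r) F i) = \sum_(i <- r) (x ⊗ F i).
Proof. exact: (big_morph (tens x) (tensDr x) (tens0r x)). Qed.

End Tensor.

Notation "x ⊗ y" := (tens x y) : ring_scope.

Lemma linearDZ (A : pzRingType) (M N : lmodType A) (f : M -> N) : linear f ->
  {morph f : x y / x + y} /\ (forall a x, f (a *: x) = a *: f x).
Proof.
move=> fl; have fD : {morph f : x y / x + y}.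
  by move=> x y; rewrite -[x in LHS]scale1r fl scale1r.
split=> // a x; have f0 : f 0 = 0.
  by apply: (addIr (f 0)); rewrite -fD !add0r.
by rewrite -[a *: x]addr0 fl f0 addr0.
Qed.

Section TensorMap.
Variable A : pzRingType.

(* f ⊗ g; meaningful when f and g are linear (tmap_tens).                     *)
Definition tmap (M M' : rmodType A) (N N' : lmodType A)
    (f : M -> M') (g : N -> N') : tensor M N -> tensor M' N' :=
  tlift (fun x y => f x ⊗ g y).

Variables (M M' : rmodType A) (N N' : lmodType A) (f : M -> M') (g : N -> N').
Hypotheses (fl : rlinear f) (gl : linear g).

Lemma tmap_balanced : balanced (fun x y => f x ⊗ g y).
Proof.
case: fl => fD fZ; have [gD gZ] := linearDZ gl.
by split=> *; rewrite ?fD ?gD ?fZ ?gZ ?tensDl ?tensDr ?tens_bal.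
Qed.

Lemma tmap_tens x y : tmap f g (x ⊗ y) = f x ⊗ g y.
Proof. exact: tlift_tens tmap_balanced. Qed.

Lemma tmapD : {morph tmap f g : u v / u + v}.
Proof. by move=> u v; apply: tliftD tmap_balanced. Qed.

End TensorMap.

Lemma rlinear_id (A : pzRingType) (M : rmodType A) : rlinear (@id M).
Proof. by []. Qed.

Lemma linear_id (A : pzRingType) (M : lmodType A) : linear (@id M).
Proof. by []. Qed.

Section TensorRight.
Variables (A B : pzRingType) (M : rmodType A) (N : bimodType A B).

Definition tensor_rscale (u : tensor M N) (b : B) : tensor M N :=
  tmap id (fun y : N => y ** b) u.

Lemma linear_rscale (b : B) : linear (fun y : N => y ** b).
Proof. by move=> a x y; rewrite rscaleDl scale_rscale. Qed.

Lemma tensor_rscaleE x y b : tensor_rscale (x ⊗ y) b = x ⊗ (y ** b).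
Proof. exact: tmap_tens (rlinear_id M) (linear_rscale b) _ _. Qed.

Lemma tensor_rscaleDl u v b :
  tensor_rscale (u + v) b = tensor_rscale u b + tensor_rscale v b.
Proof. exact: tmapD (rlinear_id M) (linear_rscale b) _ _. Qed.

Lemma tensor_rscaleA u b c :
  tensor_rscale (tensor_rscale u b) c = tensor_rscale u (b * c).
Proof.
move: u; apply: tensor_ext => [u v|u v|x y]; rewrite ?tensor_rscaleDl //.
by rewrite !tensor_rscaleE rscaleA.
Qed.

Lemma tensor_rscale1 u : tensor_rscale u 1 = u.
Proof.
move: u; apply: (tensor_ext (g := id)) => [u v|//|x y].
  by rewrite tensor_rscaleDl.
by rewrite tensor_rscaleE rscale1.
Qed.

Lemma tensor_rscaleDr u b c :
  tensor_rscale u (b + c) = tensor_rscale u b + tensor_rscale u c.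
Proof.
move: u; apply: tensor_ext => [u v|u v|x y]; rewrite ?tensor_rscaleDl //.
  by rewrite addrACA.
by rewrite !tensor_rscaleE rscaleDr tensDr.
Qed.

HB.instance Definition _ := Zmodule_isRmodule.Build B (tensor M N)
  tensor_rscaleA tensor_rscale1 tensor_rscaleDl tensor_rscaleDr.

Lemma rscale_tens x y (b : B) : (x ⊗ y : tensor M N) ** b = x ⊗ (y ** b).
Proof. exact: tensor_rscaleE. Qed.

End TensorRight.

Section TensorLeft.
Variables (A B : pzRingType) (M : bimodType B A) (N : lmodType A).

Definition tensor_lscale (b : B) (u : tensor M N) : tensor M N :=
  tmap (fun x : M => b *: x) id u.

Lemma rlinear_lscale (b : B) : rlinear (fun x : M => b *: x).
Proof. by split=> [x y|x a]; [exact: scalerDr | exact: scale_rscale]. Qed.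

Lemma tensor_lscaleE x y b : tensor_lscale b (x ⊗ y) = (b *: x) ⊗ y.
Proof. exact: tmap_tens (rlinear_lscale b) (@linear_id _ N) _ _. Qed.

Lemma tensor_lscaleDr b : {morph tensor_lscale b : u v / u + v}.
Proof. exact: tmapD (rlinear_lscale b) (@linear_id _ N). Qed.

Lemma tensor_lscaleA b c u :
  tensor_lscale b (tensor_lscale c u) = tensor_lscale (b * c) u.
Proof.
move: u; apply: tensor_ext => [u v|u v|x y]; rewrite ?tensor_lscaleDr //.
by rewrite !tensor_lscaleE scalerA.
Qed.

Lemma tensor_lscale1 : left_id 1 tensor_lscale.
Proof.
apply: (tensor_ext (g := id)) => [u v|//|x y].
  by rewrite tensor_lscaleDr.
by rewrite tensor_lscaleE scale1r.
Qed.

Lemma tensor_lscaleDl u : {morph tensor_lscale^~ u : b c / b + c}.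
Proof.
move=> b c; move: u; apply: tensor_ext => [u v|u v|x y].
- exact: tensor_lscaleDr.
- by rewrite !tensor_lscaleDr addrACA.
by rewrite !tensor_lscaleE scalerDl tensDl.
Qed.

HB.instance Definition _ := GRing.Zmodule_isLmodule.Build B (tensor M N)
  tensor_lscaleA tensor_lscale1 tensor_lscaleDr tensor_lscaleDl.

Lemma scale_tens x y (b : B) : b *: (x ⊗ y : tensor M N) = (b *: x) ⊗ y.
Proof. exact: tensor_lscaleE. Qed.

End TensorLeft.

Section TensorBimodule.
Variables (A B C : pzRingType) (M : bimodType B A) (N : bimodType A C).

Lemma tensor_scale_rscale (b : B) (u : tensor M N) (c : C) :
  b *: (u ** c) = (b *: u) ** c.
Proof.
move: u; apply: tensor_ext => [u v|u v|x y].
- by rewrite rscaleDl scalerDr.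
- by rewrite scalerDr rscaleDl.
by rewrite rscale_tens !scale_tens rscale_tens.
Qed.

HB.instance Definition _ :=
  LRmodule_isBimodule.Build B C (tensor M N) tensor_scale_rscale.

End TensorBimodule.

Section Associator.
Variables (A B : pzRingType) (M : rmodType A) (N : bimodType A B).
Variable P : lmodType B.

(* (x ⊗ y) ⊗ z |-> x ⊗ (y ⊗ z)                                                *)
Definition tassoc : tensor (tensor M N) P -> tensor M (tensor N P) :=
  tlift (fun u z => tlift (fun x y => x ⊗ (y ⊗ z)) u).

Lemma tassoc_balanced1 z :
  balanced (fun (x : M) (y : N) => x ⊗ (y ⊗ z : tensor N P)).
Proof.
by split=> *; rewrite ?tensDl ?tensDr ?tens_bal // scale_tens.
Qed.

Lemma tassoc_balanced2 :
  balanced (fun (u : tensor M N) (z : P) =>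
              tlift (fun x y => x ⊗ (y ⊗ z : tensor N P)) u).
Proof.
split=> [u v z|u z z'|u b z].
- exact: tliftD (tassoc_balanced1 z).
- move: u; apply: tensor_ext => [u v|u v|x y].
  + exact: tliftD (tassoc_balanced1 _).
  + by rewrite !(tliftD _ _ (tassoc_balanced1 _)) addrACA.
  by rewrite !(tlift_tens _ _ (tassoc_balanced1 _)) !tensDr.
- move: u; apply: tensor_ext => [u v|u v|x y].
  + by rewrite rscaleDl (tliftD _ _ (tassoc_balanced1 _)).
  + exact: tliftD (tassoc_balanced1 _).
  by rewrite rscale_tens !(tlift_tens _ _ (tassoc_balanced1 _)) tens_bal.
Qed.

Lemma tassoc_tens x y z : tassoc ((x ⊗ y) ⊗ z) = x ⊗ (y ⊗ z).
Proof.
by rewrite /tassoc (tlift_tens _ _ tassoc_balanced2)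
  (tlift_tens _ _ (tassoc_balanced1 _)).
Qed.

Lemma tassocD : {morph tassoc : u v / u + v}.
Proof. by move=> u v; apply: tliftD tassoc_balanced2. Qed.

End Associator.

Definition lflat (A : pzRingType) (C : lmodType A) : Prop :=
  forall (M N : rmodType A) (f : M -> N), rlinear f -> injective f ->
    injective (tmap f id : tensor M C -> tensor N C).

Record coring (A : pzRingType) := Coring {
  coring_sort :> bimodType A A;
  comul : coring_sort -> tensor coring_sort coring_sort;
  counit : coring_sort -> A;
  comul_bimodule_linear : bimodule_linear comul;
  counit_bimodule_linear : bimodule_linear (counit : coring_sort -> A^o);
  comulA : forall c, tassoc (tmap comul id (comul c)) = tmap id comul (comul c);
  counitl : forall c, tlift (fun x y : coring_sort => counit x *: y) (comul c) = c;
  counitr : forall c, tlift (fun x y : coring_sort => x ** counit y) (comul c) = c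
}.

Section Comodules.
Variables (A : pzRingType) (C : coring A).

Record comodule := Comodule {
  comodule_sort :> rmodType A;
  coact : comodule_sort -> tensor comodule_sort C;
  coact_rlinear : rlinear coact;
  coactA : forall x,
    tassoc (tmap coact id (coact x)) = tmap id (@comul A C) (coact x);
  coact_counit : forall x, tlift (fun y c => y ** counit c) (coact x) = x
}.

Record comod_hom (M N : comodule) := ComodHom {
  comod_fun :> M -> N;
  comod_hom_rlinear : rlinear comod_fun;
  comod_hom_coact : forall x, coact (comod_fun x) = tmap comod_fun id (coact x)
}.

(* Categorical epimorphisms in the category of right C-comodules.             *)
Definition epimorphism (M N : comodule) (f : comod_hom M N) : Prop :=
  forall (P : comodule) (g h : comod_hom N P),
    (forall x, g (f x) = h (f x)) -> forall y, g y = h y.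

Definition quasi_projective (S : comodule) : Prop :=
  forall (N : comodule) (p : comod_hom S N), epimorphism p ->
  forall g : comod_hom S N, exists h : comod_hom S S, forall x, p (h x) = g x.

(* A subcomodule of M, as a comodule N with an injective homomorphism         *)
(* N -> M, hence determined up to isomorphism over M.                         *)
Definition subcomodule (N M : comodule) : Prop :=
  exists i : comod_hom N M, injective i.

End Comodules.

(* {malg M[I]} is the type of finitely supported functions I -> M, i.e. the   *)
(* direct sum M^(I).                                                          *)

Section DirectSumModule.
Variables (A : pzRingType) (I : choiceType) (M : rmodType A).
Implicit Types (g : {malg M[I]}) (a : A).

Lemma rscale0l a : (0 : M) ** a = 0.
Proof. by apply: (addIr ((0 : M) ** a)); rewrite -rscaleDl !add0r. Qed.

Definition malg_rscale g a : {malg M[I]} := [malg i in msupp g => g@_i ** a].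

Lemma malg_rscaleE g a i : (malg_rscale g a)@_i = g@_i ** a.
Proof. by rewrite mcoeffE; case: msuppP => // _; rewrite rscale0l. Qed.

Lemma malg_rscaleA g a b :
  malg_rscale (malg_rscale g a) b = malg_rscale g (a * b).
Proof. by apply/malgP=> i; rewrite !malg_rscaleE rscaleA. Qed.

Lemma malg_rscale1 g : malg_rscale g 1 = g.
Proof. by apply/malgP=> i; rewrite malg_rscaleE rscale1. Qed.

Lemma malg_rscaleDl g h a :
  malg_rscale (g + h) a = malg_rscale g a + malg_rscale h a.
Proof. by apply/malgP=> i; rewrite !(malg_rscaleE, mcoeffD) rscaleDl. Qed.

Lemma malg_rscaleDr g a b :
  malg_rscale g (a + b) = malg_rscale g a + malg_rscale g b.
Proof. by apply/malgP=> i; rewrite !(malg_rscaleE, mcoeffD) rscaleDr. Qed.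

HB.instance Definition _ := Zmodule_isRmodule.Build A {malg M[I]}
  malg_rscaleA malg_rscale1 malg_rscaleDl malg_rscaleDr.

Definition dsum_in (i : I) (x : M) : {malg M[I]} := << x *g i >>.

Lemma dsum_inE i x j : (dsum_in i x)@_j = if i == j then x else 0.
Proof. by rewrite mcoeffU mulrb. Qed.

Lemma dsum_in_rlinear i : rlinear (dsum_in i).
Proof.
split=> [x y|x a]; apply/malgP=> j.
  by rewrite mcoeffD !dsum_inE; case: eqP; rewrite ?addr0.
by rewrite malg_rscaleE !dsum_inE; case: eqP; rewrite ?rscale0l.
Qed.

Section Lift.
Variables (V : zmodType) (h : I -> M -> V).
Hypothesis hD : forall i, {morph h i : x y / x + y}.

Definition dsum_lift g : V := \sum_(i <- msupp g) h i g@_i.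

Let h0 i : h i 0 = 0.
Proof. by apply: (addIr (h i 0)); rewrite -hD !add0r. Qed.

Lemma dsum_liftEw (d : {fset I}) g : (msupp g `<=` d)%fset ->
  dsum_lift g = \sum_(i <- d) h i g@_i.
Proof.
move=> sgd; rewrite /dsum_lift (big_fset_incl _ sgd) // => i _ /mcoeff_outdom->.
exact: h0.
Qed.

Lemma dsum_liftD : {morph dsum_lift : f g / f + g}.
Proof.
move=> f g; pose d := (msupp f `|` msupp g `|` msupp (f + g))%fset.
rewrite !(@dsum_liftEw d) /d -?fsetUA ?fsubsetUl //; first last.
- by rewrite !fsetUA fsubsetUr.
- by rewrite fsetUCA fsubsetUl.
by rewrite -big_split; apply: eq_bigr => i _; rewrite mcoeffD hD.
Qed.

Lemma dsum_lift_in i x : dsum_lift (dsum_in i x) = h i x.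
Proof.
rewrite (@dsum_liftEw [fset i]%fset) ?msuppU_le //.
by rewrite big_seq_fset1 dsum_inE eqxx.
Qed.

End Lift.

Lemma dsum_ext (V : zmodType) (f g : {malg M[I]} -> V) :
    {morph f : x y / x + y} -> {morph g : x y / x + y} ->
    (forall i x, f (dsum_in i x) = g (dsum_in i x)) -> f =1 g.
Proof.
move=> fD gD fg x.
have E (h : {malg M[I]} -> V) : {morph h : x y / x + y} -> h 0 = 0.
  by move=> hD; apply: (addIr (h 0)); rewrite -hD !add0r.
rewrite [x]monalgE (big_morph f fD (E _ fD)) (big_morph g gD (E _ gD)).
by apply: eq_bigr => i _; apply: fg.
Qed.

End DirectSumModule.

Section TmapTheory.
Variable A : pzRingType.

Lemma rlinear_comp (M N P : rmodType A) (f : N -> P) (g : M -> N) :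
  rlinear f -> rlinear g -> rlinear (fun x => f (g x)).
Proof.
by case=> fD fZ [gD gZ]; split=> [x y|x a]; rewrite ?gD ?gZ ?fD ?fZ.
Qed.

Lemma tmap_comp (M M' M'' : rmodType A) (N N' N'' : lmodType A)
    (f : M' -> M'') (f' : M -> M') (g : N' -> N'') (g' : N -> N') :
  rlinear f -> rlinear f' -> linear g -> linear g' ->
  forall u, tmap f g (tmap f' g' u)
            = tmap (fun x => f (f' x)) (fun y => g (g' y)) u.
Proof.
move=> fl fl' gl gl'.
have ffl := rlinear_comp fl fl'.
have ggl : linear (fun y => g (g' y)) by move=> a x y; rewrite gl' gl.
apply: tensor_ext => [u v|u v|x y]; rewrite ?tmapD //.
by rewrite !tmap_tens.
Qed.

Lemma tmap_eq (M M' : rmodType A) (N N' : lmodType A)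
    (f f' : M -> M') (g g' : N -> N') :
  f =1 f' -> g =1 g' -> tmap f g =1 tmap f' g'.
Proof. by move=> /funext-> /funext->. Qed.

Lemma tmap_rlinear (B : pzRingType) (M M' : rmodType A) (N N' : bimodType A B)
    (f : M -> M') (g : N -> N') :
  rlinear f -> bimodule_linear g -> rlinear (tmap f g).
Proof.
move=> fl [gl [gD gZ]]; split; first exact: tmapD.
move=> u b; move: u; apply: tensor_ext => [u v|u v|x y].
- by rewrite rscaleDl tmapD.
- by rewrite tmapD // rscaleDl.
by rewrite rscale_tens !tmap_tens // rscale_tens gZ.
Qed.

Lemma id_bimodule_linear (B : pzRingType) (M : bimodType A B) :
  bimodule_linear (@id M).
Proof. by []. Qed.

Lemma tassoc_tmap (B : pzRingType) (M M' : rmodType A) (N : bimodType A B)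
    (P : lmodType B) (f : M -> M') : rlinear f ->
  forall u : tensor (tensor M N) P,
    tassoc (tmap (tmap f id) id u) = tmap f id (tassoc u).
Proof.
move=> fl; have idN := id_bimodule_linear N.
have idl := @linear_id.
have tfl := tmap_rlinear fl idN.
apply: tensor_ext => [u v|u v|u z].
- by rewrite (tmapD tfl (@linear_id _ P)) tassocD.
- by rewrite tassocD (tmapD fl (@linear_id _ _)).
rewrite (tmap_tens tfl (@linear_id _ P)).
move: u; apply: tensor_ext => [u v|u v|x y].
- by rewrite tfl.1 tensDl tassocD.
- by rewrite tensDl tassocD (tmapD fl (@linear_id _ _)).
by rewrite (tmap_tens fl (@linear_id _ N)) !tassoc_tens
  (tmap_tens fl (@linear_id _ _)).
Qed.

End TmapTheory.

Section DirectSumComodule.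
Variables (A : pzRingType) (C : coring A) (I : choiceType) (M : comodule C).

Definition dsum_coact : {malg M[I]} -> tensor {malg M[I]} C :=
  dsum_lift (fun i x => tmap (@dsum_in A I M i) id (coact x)).

Let inl i := dsum_in_rlinear M i : rlinear (@dsum_in A I M i).
Let idl := @linear_id A C.
Let idb := id_bimodule_linear C.
Let Dl := linearDZ (comul_bimodule_linear C).1.

Let hD i : {morph (fun x : M => tmap (@dsum_in A I M i) id (coact x)) :
  x y / x + y}.
Proof. by move=> x y; rewrite (coact_rlinear M).1 tmapD. Qed.

Lemma dsum_coactD : {morph dsum_coact : g h / g + h}.
Proof. exact: dsum_liftD hD. Qed.

Lemma dsum_coact_in i x :
  dsum_coact (dsum_in i x) = tmap (@dsum_in A I M i) id (coact x).
Proof. exact: dsum_lift_in hD i x. Qed.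

Lemma dsum_coact_rlinear : rlinear dsum_coact.
Proof.
split=> [|g a]; first exact: dsum_coactD.
move: g; apply: dsum_ext => [g h|g h|i x].
- by rewrite rscaleDl dsum_coactD.
- by rewrite dsum_coactD rscaleDl.
rewrite -(inl i).2 !dsum_coact_in (coact_rlinear M).2.
by rewrite (tmap_rlinear (inl i) idb).2.
Qed.

Lemma dsum_coactA g :
  tassoc (tmap dsum_coact id (dsum_coact g))
    = tmap id (@comul A C) (dsum_coact g).
Proof.
have dl := dsum_coact_rlinear; have Cl := (comul_bimodule_linear C).1.
move: g; apply: dsum_ext => [g h|g h|i x].
- by rewrite dsum_coactD (tmapD dl idl) tassocD.
- by rewrite dsum_coactD (tmapD (@rlinear_id _ _) Cl).
rewrite dsum_coact_in (tmap_comp dl (inl i) idl idl).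
rewrite (tmap_eq (dsum_coact_in i) (frefl _)).
rewrite -(tmap_comp (tmap_rlinear (inl i) idb) (coact_rlinear M) idl idl).
rewrite (tassoc_tmap (inl i)) coactA.
rewrite (tmap_comp (inl i) (@rlinear_id _ _) (@linear_id _ _) Cl).
by rewrite (tmap_comp (@rlinear_id _ _) (inl i) Cl idl).
Qed.

Lemma rscale_counit_balanced (N : rmodType A) :
  balanced (fun (y : N) (c : C) => y ** counit c).
Proof.
have [l [D _]] := counit_bimodule_linear C; have [_ Z] := linearDZ l.
split=> [x x' y|x y y'|x a y]; first exact: rscaleDl.
  by rewrite D rscaleDr.
by rewrite rscaleA Z.
Qed.

Lemma dsum_coact_counit g : tlift (fun y c => y ** counit c) (dsum_coact g) = g.
Proof.
have bal := rscale_counit_balanced.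
move: g; apply: (dsum_ext (g := id)) => [g h|//|i x].
  by rewrite dsum_coactD (tliftD _ _ (bal _)).
rewrite dsum_coact_in -[x in RHS]coact_counit.
move: (coact x); apply: tensor_ext => [u v|u v|y c].
- by rewrite (tmapD (inl i) idl) (tliftD _ _ (bal _)).
- by rewrite (tliftD _ _ (bal _)) (inl i).1.
by rewrite (tmap_tens (inl i) idl) !(tlift_tens _ _ (bal _)) (inl i).2.
Qed.

Definition dsum : comodule C :=
  Comodule dsum_coact_rlinear dsum_coactA dsum_coact_counit.

End DirectSumComodule.

Definition generates (A : pzRingType) (C : coring A) (S N : comodule C) : Prop :=
  exists (I : choiceType) (p : comod_hom (dsum I S) N), epimorphism p.

Section Endo.
Variables (A : pzRingType) (C : coring A) (S : comodule C).

Definition endo : Type := comod_hom S S.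

HB.instance Definition _ := gen_eqMixin endo.
HB.instance Definition _ := gen_choiceMixin endo.

Implicit Types s t : endo.

Lemma endoP s t : (forall x, s x = t x) <-> s = t.
Proof.
split=> [|-> //]; case: s t => [s sl sC] [t tl tC] /= /funext st.
case: _ / st in tl tC *; congr ComodHom; exact: Prop_irrelevance.
Qed.

Let idl := @linear_id A C.

Lemma endo_add_rlinear s t : rlinear (fun x : S => s x + t x).
Proof.
have [[sD sZ] [tD tZ]] := (comod_hom_rlinear s, comod_hom_rlinear t).
by split=> [x y|x a]; rewrite ?sD ?tD ?sZ ?tZ ?rscaleDl // addrACA.
Qed.

Lemma endo_add_coact s t x :
  coact (s x + t x) = tmap (fun x : S => s x + t x) id (coact x).
Proof.
have [sl tl] := (comod_hom_rlinear s, comod_hom_rlinear t).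
have stl := endo_add_rlinear s t.
rewrite (coact_rlinear S).1 !comod_hom_coact.
move: (coact x); apply: tensor_ext => [u v|u v|y c].
- by rewrite !tmapD // addrACA.
- by rewrite tmapD.
by rewrite !tmap_tens // tensDl.
Qed.

Definition endo_add s t : endo :=
  ComodHom (endo_add_rlinear s t) (endo_add_coact s t).

Lemma endo_zero_rlinear : rlinear (fun _ : S => 0 : S).
Proof. by split=> [x y|x a]; rewrite ?addr0 ?rscale0l. Qed.

Lemma endo_zero_coact (x : S) :
  coact (0 : S) = tmap (fun _ : S => 0 : S) id (coact x).
Proof.
have -> : coact (0 : S) = 0.
  by apply: (addIr (coact (0 : S))); rewrite -(coact_rlinear S).1 !add0r.
move: (coact x); apply: (tensor_ext (f := fun=> 0)) => [u v|u v|y c].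
- by rewrite addr0.
- by rewrite (tmapD endo_zero_rlinear idl).
by rewrite (tmap_tens endo_zero_rlinear idl) tens0l.
Qed.

Definition endo_zero : endo := ComodHom endo_zero_rlinear endo_zero_coact.

Lemma endo_opp_rlinear s : rlinear (fun x : S => - s x).
Proof.
have [sD sZ] := comod_hom_rlinear s.
split=> [x y|x a]; first by rewrite sD opprD.
rewrite sZ; apply: (addIr (s x ** a)); rewrite addNr -rscaleDl addNr.
by rewrite rscale0l.
Qed.

Lemma endo_opp_coact s x :
  coact (- s x) = tmap (fun x : S => - s x) id (coact x).
Proof.
have sl := comod_hom_rlinear s; have nl := endo_opp_rlinear s.
apply: (addIr (coact (s x))); rewrite -(coact_rlinear S).1 addNr.
rewrite (endo_zero_coact x) comod_hom_coact.
move: (coact x); apply: tensor_ext => [u v|u v|y c].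
- by rewrite (tmapD endo_zero_rlinear idl).
- by rewrite !tmapD // addrACA.
by rewrite (tmap_tens endo_zero_rlinear idl) !tmap_tens // -tensDl addNr.
Qed.

Definition endo_opp s : endo :=
  ComodHom (endo_opp_rlinear s) (endo_opp_coact s).

Lemma endo_addA : associative endo_add.
Proof. by move=> r s t; apply/endoP => x; apply: addrA. Qed.
Lemma endo_addC : commutative endo_add.
Proof. by move=> s t; apply/endoP => x; apply: addrC. Qed.
Lemma endo_add0 : left_id endo_zero endo_add.
Proof. by move=> s; apply/endoP => x; apply: add0r. Qed.
Lemma endo_addN : left_inverse endo_zero endo_opp endo_add.
Proof. by move=> s; apply/endoP => x; apply: addNr. Qed.

HB.instance Definition _ := GRing.isZmodule.Build endo
  endo_addA endo_addC endo_add0 endo_addN.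

Lemma endo_one_coact (x : S) : coact x = tmap (@id S) id (coact x).
Proof.
move: (coact x); apply: tensor_ext => [//|u v|y c].
  by rewrite (tmapD (@rlinear_id _ _) idl).
by rewrite (tmap_tens (@rlinear_id _ _) idl).
Qed.

Definition endo_one : endo := ComodHom (@rlinear_id _ S) endo_one_coact.

Lemma endo_mul_rlinear s t : rlinear (fun x : S => s (t x)).
Proof. exact: rlinear_comp (comod_hom_rlinear s) (comod_hom_rlinear t). Qed.

Lemma endo_mul_coact s t x :
  coact (s (t x)) = tmap (fun x : S => s (t x)) id (coact x).
Proof.
rewrite !comod_hom_coact.
by rewrite (tmap_comp (comod_hom_rlinear s) (comod_hom_rlinear t) idl idl).
Qed.

Definition endo_mul s t : endo :=
  ComodHom (endo_mul_rlinear s t) (endo_mul_coact s t).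

Lemma endo_mulA : associative endo_mul.
Proof. by move=> r s t; apply/endoP. Qed.
Lemma endo_mul1 : left_id endo_one endo_mul.
Proof. by move=> s; apply/endoP. Qed.
Lemma endo_1mul : right_id endo_one endo_mul.
Proof. by move=> s; apply/endoP. Qed.
Lemma endo_mulDl : left_distributive endo_mul +%R.
Proof. by move=> r s t; apply/endoP. Qed.
Lemma endo_mulDr : right_distributive endo_mul +%R.
Proof. by move=> r s t; apply/endoP => x; apply: (comod_hom_rlinear r).1. Qed.

HB.instance Definition _ := GRing.Zmodule_isPzRing.Build endo
  endo_mulA endo_mul1 endo_1mul endo_mulDl endo_mulDr.

(* A copy of S carrying the T-A-bimodule structure, T = endo S.               *)
Definition lendo : Type := S.
HB.instance Definition _ := Rmodule.copy lendo S.

Definition lendo_scale (t : endo) (x : lendo) : lendo := t x.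

HB.instance Definition _ := GRing.Zmodule_isLmodule.Build endo lendo
  (scale := lendo_scale)
  (fun _ _ _ => erefl) (fun _ => erefl)
  (fun t => (comod_hom_rlinear t).1) (fun _ _ _ => erefl).

Lemma lendo_scale_rscale (t : endo) (x : lendo) (a : A) :
  t *: (x ** a) = (t *: x) ** a.
Proof. exact: (comod_hom_rlinear t).2. Qed.

HB.instance Definition _ :=
  LRmodule_isBimodule.Build endo A lendo lendo_scale_rscale.

End Endo.

Section Dual.
Variables (A : pzRingType) (M : rmodType A).

Record dual := Dual {
  dual_fun :> M -> A;
  dual_rlinear : rlinear (dual_fun : M -> A^o)
}.

HB.instance Definition _ := gen_eqMixin dual.
HB.instance Definition _ := gen_choiceMixin dual.

Implicit Types f g : dual.

Lemma dualP f g : (forall x, f x = g x) <-> f = g.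
Proof.
split=> [|-> //]; case: f g => [f fl] [g gl] /= /funext fg.
case: _ / fg in gl *; congr Dual; exact: Prop_irrelevance.
Qed.

Lemma dualD f x y : f (x + y) = f x + f y.
Proof. exact: (dual_rlinear f).1. Qed.
Lemma dualZ f x a : f (x ** a) = f x * a.
Proof. exact: (dual_rlinear f).2. Qed.

Lemma dual_add_rlinear f g : rlinear (fun x => f x + g x : A^o).
Proof.
split=> [x y|x a]; first by rewrite !dualD addrACA.
by rewrite !dualZ -mulrDl.
Qed.
Definition dual_add f g : dual := Dual (dual_add_rlinear f g).

Lemma dual_zero_rlinear : rlinear (fun _ : M => 0 : A^o).
Proof. by split=> [x y|x a]; rewrite ?addr0 ?rscale0l. Qed.
Definition dual_zero : dual := Dual dual_zero_rlinear.

Lemma dual_opp_rlinear f : rlinear (fun x => - f x : A^o).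
Proof.
split=> [x y|x a]; first by rewrite dualD opprD.
by rewrite dualZ -mulNr.
Qed.
Definition dual_opp f : dual := Dual (dual_opp_rlinear f).

Lemma dual_addA : associative dual_add.
Proof. by move=> f g h; apply/dualP => x; apply: addrA. Qed.
Lemma dual_addC : commutative dual_add.
Proof. by move=> f g; apply/dualP => x; apply: addrC. Qed.
Lemma dual_add0 : left_id dual_zero dual_add.
Proof. by move=> f; apply/dualP => x; apply: add0r. Qed.
Lemma dual_addN : left_inverse dual_zero dual_opp dual_add.
Proof. by move=> f; apply/dualP => x; apply: addNr. Qed.

HB.instance Definition _ := GRing.isZmodule.Build dual
  dual_addA dual_addC dual_add0 dual_addN.

Lemma dual_scale_rlinear a f : rlinear (fun x => a * f x : A^o).
Proof.
split=> [x y|x b]; first by rewrite dualD mulrDr.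
by rewrite dualZ mulrA.
Qed.
Definition dual_scale a f : dual := Dual (dual_scale_rlinear a f).

Lemma dual_scaleA a b f : dual_scale a (dual_scale b f) = dual_scale (a * b) f.
Proof. by apply/dualP => x; apply: mulrA. Qed.
Lemma dual_scale1 : left_id 1 dual_scale.
Proof. by move=> f; apply/dualP => x; apply: mul1r. Qed.
Lemma dual_scaleDr : right_distributive dual_scale +%R.
Proof. by move=> a f g; apply/dualP => x; apply: mulrDr. Qed.
Lemma dual_scaleDl f : {morph dual_scale^~ f : a b / a + b}.
Proof. by move=> a b; apply/dualP => x; apply: mulrDl. Qed.

HB.instance Definition _ := GRing.Zmodule_isLmodule.Build A dual
  dual_scaleA dual_scale1 dual_scaleDr dual_scaleDl.

End Dual.

Section DualEndo.
Variables (A : pzRingType) (C : coring A) (S : comodule C).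
Implicit Types (f : dual S) (t : endo S).

Lemma dual_rscale_rlinear f t : rlinear (fun x => f (t x) : A^o).
Proof. exact: rlinear_comp (dual_rlinear f) (comod_hom_rlinear t). Qed.
Definition dual_rscale f t : dual S := Dual (dual_rscale_rlinear f t).

Lemma dual_rscaleDr f s t :
  dual_rscale f (s + t) = dual_rscale f s + dual_rscale f t.
Proof. by apply/dualP => x; apply: dualD. Qed.

Fact dual_rscaleA f s t : dual_rscale (dual_rscale f s) t = dual_rscale f (s * t).
Proof. exact/dualP. Qed.
Fact dual_rscale1 f : dual_rscale f 1 = f.
Proof. exact/dualP. Qed.
Fact dual_rscaleDl f g t :
  dual_rscale (f + g) t = dual_rscale f t + dual_rscale g t.
Proof. exact/dualP. Qed.

HB.instance Definition _ := Zmodule_isRmodule.Build (endo S) (dual S)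
  dual_rscaleA dual_rscale1 dual_rscaleDl dual_rscaleDr.

Fact dual_scale_rscale (a : A) f t : a *: (f ** t) = (a *: f) ** t.
Proof. exact/dualP. Qed.

HB.instance Definition _ :=
  LRmodule_isBimodule.Build A (endo S) (dual S) dual_scale_rscale.

End DualEndo.

Section Contract.
Variables (A : pzRingType) (M : rmodType A) (f : dual M).

(* M ⊗_A N -> N, x ⊗ y |-> f(x) y                                             *)
Definition contract (N : lmodType A) : tensor M N -> N :=
  tlift (fun x y => f x *: y).

Lemma contract_balanced (N : lmodType A) :
  balanced (fun (x : M) (y : N) => f x *: y).
Proof.
split=> [x x' y|x y y'|x a y]; first by rewrite dualD scalerDl.
  by rewrite scalerDr.
by rewrite dualZ scalerA.
Qed.

Lemma contract_tens (N : lmodType A) x (y : N) : contract (x ⊗ y) = f x *: y.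
Proof. exact: tlift_tens (contract_balanced N). Qed.

Lemma contractD (N : lmodType A) : {morph @contract N : u v / u + v}.
Proof. by move=> u v; apply: tliftD (contract_balanced N). Qed.

Lemma contract_rlinear (B : pzRingType) (N : bimodType A B) :
  rlinear (@contract N).
Proof.
split=> [|u b]; first exact: contractD.
move: u; apply: tensor_ext => [u v|u v|x y].
- by rewrite rscaleDl contractD.
- by rewrite contractD rscaleDl.
by rewrite rscale_tens !contract_tens scale_rscale.
Qed.

End Contract.

Section Can.
Variables (A : pzRingType) (C : coring A) (S : comodule C).

Definition comatrix := tensor (dual S) (lendo S).
HB.instance Definition _ := Bimodule.on comatrix.

(* f ⊗ x |-> sum f(x_0) x_1                                                   *)
Definition can : comatrix -> C :=
  tlift (fun (f : dual S) (x : lendo S) => contract f (coact x)).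

(* See can_bimodule_linear, can_counit and can_comul below: can is always a   *)
(* homomorphism of A-corings, hence an isomorphism as soon as it is           *)
(* bijective.                                                                 *)
Definition galois : Prop := bijective can.

Lemma can_balanced :
  balanced (fun (f : dual S) (x : lendo S) => contract f (coact x)).
Proof.
split=> [f g x|f x y|f t x].
- move: (coact x); apply: tensor_ext => [u v|u v|y c].
  + exact: contractD.
  + by rewrite !contractD addrACA.
  by rewrite !contract_tens scalerDl.
- by rewrite (coact_rlinear S).1 contractD.
rewrite [X in _ = contract _ X](comod_hom_coact t).
have tl := comod_hom_rlinear t; have il := @linear_id A C.
move: (coact x); apply: tensor_ext => [u v|u v|y c].
- exact: contractD.
- by rewrite tmapD // contractD.
by rewrite tmap_tens // !contract_tens.
Qed.

Lemma can_tens (f : dual S) (x : lendo S) :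
  can (f ⊗ x) = contract f (coact x).
Proof. exact: tlift_tens can_balanced. Qed.

Lemma canD : {morph can : u v / u + v}.
Proof. by move=> u v; apply: tliftD can_balanced. Qed.

Lemma can_scale a u : can (a *: u) = a *: can u.
Proof.
move: u; apply: tensor_ext => [u v|u v|f x].
- by rewrite scalerDr canD.
- by rewrite canD scalerDr.
rewrite [a *: _]scale_tens !can_tens.
move: (coact x); apply: tensor_ext => [u v|u v|y c].
- exact: contractD.
- by rewrite contractD scalerDr.
by rewrite !contract_tens scalerA.
Qed.

Lemma can_rscale u a : can (u ** a) = can u ** a.
Proof.
move: u; apply: tensor_ext => [u v|u v|f x].
- by rewrite rscaleDl canD.
- by rewrite canD rscaleDl.
rewrite [_ ** a]rscale_tens !can_tens (coact_rlinear S).2.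
exact: (contract_rlinear f C).2.
Qed.

Lemma can_bimodule_linear : bimodule_linear can.
Proof.
split; first by move=> a u v; rewrite canD can_scale.
by split; [exact: canD | exact: can_rscale].
Qed.

(* The comatrix coring structure on S^* ⊗_T S; the comultiplication is given  *)
(* by a finite dual basis (e', e) of S.                                       *)
Definition comatrix_counit : comatrix -> A :=
  tlift (fun (f : dual S) (x : lendo S) => f x).

Definition dual_basis n (e' : 'I_n -> dual S) (e : 'I_n -> S) : Prop :=
  forall x, x = \sum_i e i ** e' i x.

Definition comatrix_comul n (e' : 'I_n -> dual S) (e : 'I_n -> S) :
    comatrix -> tensor comatrix comatrix :=
  tlift (fun (f : dual S) (x : lendo S) =>
    \sum_i ((f ⊗ (e i : lendo S) : comatrix) ⊗ (e' i ⊗ x : comatrix))).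

Lemma comatrix_counit_balanced :
  balanced (fun (f : dual S) (x : lendo S) => f x).
Proof. by split=> [//|f x y|//]; apply: dualD. Qed.

Lemma can_counit u : counit (can u) = comatrix_counit u.
Proof.
have bal := comatrix_counit_balanced.
have [cl [cD _]] := counit_bimodule_linear C; have [_ cZ] := linearDZ cl.
move: u; apply: tensor_ext => [u v|u v|f x].
- by rewrite canD cD.
- exact: tliftD.
rewrite can_tens /comatrix_counit (tlift_tens _ _ bal).
rewrite -[x in RHS](@coact_counit A C S x).
have rb := @rscale_counit_balanced A C S.
move: (coact x); apply: tensor_ext => [u v|u v|y c].
- by rewrite contractD cD.
- by rewrite (tliftD _ _ rb) dualD.
by rewrite contract_tens (tlift_tens _ _ rb) dualZ cZ.
Qed.

Section Comul.
Variables (n : nat) (e' : 'I_n -> dual S) (e : 'I_n -> S).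
Hypothesis eP : dual_basis e' e.

Lemma comatrix_comul_balanced :
  balanced (fun (f : dual S) (x : lendo S) =>
    \sum_i ((f ⊗ (e i : lendo S) : comatrix) ⊗ (e' i ⊗ x : comatrix))).
Proof.
split=> [f g x|f x y|f t x].
- by rewrite -big_split; apply: eq_bigr => i _; rewrite !tensDl.
- by rewrite -big_split; apply: eq_bigr => i _; rewrite !tensDr.
pose E i j : A := e' j (t (e i)).
have El i : (f ** t) ⊗ (e i : lendo S) =
    \sum_j (f ⊗ (e j : lendo S) : comatrix) ** E i j.
  rewrite tens_bal [_ *: _](eP (t (e i))) tens_sumr.
  by apply: eq_bigr => j _; rewrite [RHS]rscale_tens.
have Er j : e' j ⊗ (t *: x) = \sum_i E i j *: (e' i ⊗ x : comatrix).
  rewrite -tens_bal; have -> : e' j ** t = \sum_i E i j *: e' i.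
    apply/dualP => y.
    have sumE (F : 'I_n -> dual S) : (\sum_i F i) y = \sum_i F i y.
      by apply: (big_morph (fun f : dual S => f y)).
    rewrite sumE {1}[y]eP.
    transitivity (e' j (\sum_i t (e i) ** e' i y)).
      congr (e' j _); have [tD tZ] := comod_hom_rlinear t.
      have t0 : t 0 = 0 by apply: (addIr (t 0)); rewrite -tD !add0r.
      by rewrite (big_morph t tD t0); apply: eq_bigr => i _; rewrite tZ.
    have e0 : e' j 0 = 0 by apply: (addIr (e' j 0)); rewrite -dualD !add0r.
    rewrite (big_morph (e' j) (dualD (e' j)) e0).
    by apply: eq_bigr => i _; rewrite dualZ.
  by rewrite tens_suml; apply: eq_bigr => i _; rewrite [RHS]scale_tens.
under eq_bigr do rewrite El tens_suml.
under [RHS]eq_bigr do rewrite Er tens_sumr.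
rewrite exchange_big; apply: eq_bigr => j _; apply: eq_bigr => i _.
exact: tens_bal.
Qed.

Lemma can_comul u : comul (can u) = tmap can can (comatrix_comul e' e u).
Proof.
have [[canl canr] cb] := (can_bimodule_linear, comatrix_comul_balanced).
have [Cl [CD CR]] := comul_bimodule_linear C; have [_ CZ] := linearDZ Cl.
have idl := @linear_id A C.
move: u; apply: tensor_ext => [u v|u v|f x].
- by rewrite canD CD.
- by rewrite /comatrix_comul (tliftD _ _ cb) tmapD.
rewrite /comatrix_comul (tlift_tens _ _ cb) can_tens.
have fl := contract_rlinear f C.
have -> : comul (contract f (coact x))
    = contract f (tmap id (@comul A C) (coact x)).
  move: (coact x); apply: tensor_ext => [u v|u v|y c].
  - by rewrite contractD CD.
  - by rewrite (tmapD (@rlinear_id _ _) Cl) contractD.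
  by rewrite (tmap_tens (@rlinear_id _ _) Cl) !contract_tens CZ.
rewrite -coactA.
have -> w : contract f (tassoc w) = tmap (@contract A S f C) (@id C) w.
  move: w; apply: tensor_ext => [u v|u v|u c].
  - by rewrite tassocD contractD.
  - exact: tmapD.
  rewrite tmap_tens //; move: u; apply: tensor_ext => [u v|u v|y d].
  - by rewrite tensDl tassocD contractD.
  - by rewrite contractD tensDl.
  by rewrite tassoc_tens !contract_tens scale_tens.
rewrite (tmap_comp fl (coact_rlinear S) idl idl).
have fcl := rlinear_comp fl (coact_rlinear S).
have tmap0 : tmap can can (0 : tensor comatrix comatrix) = 0.
  by apply: (addIr (tmap can can 0)); rewrite -tmapD // !add0r.
rewrite (big_morph _ (tmapD canr canl) tmap0).
under eq_bigr do rewrite (tmap_tens canr canl) !can_tens.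
move: (coact x); apply: tensor_ext => [u v|u v|y c].
- exact: tmapD.
- by rewrite -big_split; apply: eq_bigr => i _; rewrite contractD tensDr.
rewrite tmap_tens // {1}[y]eP.
have fc0 : contract f (coact (0 : S)) = 0.
  by apply: (addIr (contract f (coact (0 : S)))); rewrite -fcl.1 !add0r.
rewrite (big_morph _ fcl.1 fc0) tens_suml; apply: eq_bigr => i _.
by rewrite fcl.2 contract_tens tens_bal.
Qed.

End Comul.

End Can.

(* Main.v *)
(* Let sum_i f_i ⊗ x_i be in the kernel of can. The f_i correspond to         *)
(* comodule maps S -> C, x |-> f_i(x_0) x_1, and x = (x_i) lies in the kernel *)
(* N of the resulting F : S^n -> C, which is a subcomodule of S^n because C   *)
(* is flat. As S generates N, x is a finite sum of values g_j(y_j) of         *)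
(* comodule maps g_j = (g_ij)_i : S -> N with g_ij in T. Composing F g_j = 0  *)
(* with the counit gives sum_i f_i g_ij = 0, so that                          *)
(* sum_i f_i ⊗ x_i = sum_j (sum_i f_i g_ij) ⊗ y_j = 0.                        *)

Require Import Defs.
From HB Require Import structures.
From mathcomp Require Import all_boot all_order all_algebra.
From mathcomp Require Import monalg boolp.

Set Implicit Arguments.
Unset Strict Implicit.
Unset Printing Implicit Defensive.

Import GRing.Theory.
Local Open Scope ring_scope.

(** Surjectivity of [can] is given, so the content is [can_injective]. A tensor sum_i f_i ⊗ x_i is a
    row f over the dual of S paired over T with a vector X of S^n. The row f also defines a comodule
    map F : S^n -> C, and [can] sends the tensor to F X. If F X = 0, the tensor must be shown to
    vanish because of relations f g = 0 with g a column over T. Generation supplies them: the kernel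
    of F is covered by copies of S, and each copy maps to S^n through a column g of endomorphisms
    with F g = 0. Since the counit recovers f from F ([counit_dual_hom]), this gives f g = 0, and
    balancing over T kills the tensor.

    Two facts about comodules support the argument. First, flatness makes the module kernel of a
    comodule map a subcomodule ([ker_comod]): [tmap_ker] restricts the coaction, and [lflat_tensor]
    allows coassociativity to be checked in the larger comodule. Second, categorical epimorphisms
    are surjective ([epimorphism_surjective]), so that generation yields actual preimages; this uses
    cokernels. *)

Lemma morphD0 (U V : zmodType) (f : U -> V) : {morph f : x y / x + y} -> f 0 = 0.
Proof. by move=> fD; apply: (addIr (f 0)); rewrite -fD !add0r. Qed.

Lemma morphDB (U V : zmodType) (f : U -> V) :
  {morph f : x y / x + y} -> {morph f : x y / x - y}.
Proof. by move=> fD x y; apply: (addIr (f y)); rewrite -fD !subrK. Qed.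

(** Lets closure of a [submodule] under opposites follow from [submodZ]. *)
Lemma rscaleN1 (A : pzRingType) (M : rmodType A) (x : M) : x ** -1 = - x.
Proof.
apply: (addIr (x ** 1)); rewrite -rscaleDr addNr rscale1 addNr.
exact: (morphD0 (rscaleDr x)).
Qed.

(** * Submodules, kernels and images *)

Record submodule (A : pzRingType) (M : rmodType A) := Submodule {
  submod_pred :> M -> Prop;
  submod0 : submod_pred 0;
  submodD : forall x y, submod_pred x -> submod_pred y -> submod_pred (x + y);
  submodZ : forall x a, submod_pred x -> submod_pred (x ** a)
}.

Section KernelImage.
Variables (A : pzRingType) (M N : rmodType A) (f : M -> N) (fl : rlinear f).

Fact ker_submodD x y : f x = 0 -> f y = 0 -> f (x + y) = 0.
Proof. by rewrite fl.1 => -> ->; rewrite addr0. Qed.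
Fact ker_submodZ x a : f x = 0 -> f (x ** a) = 0.
Proof. by rewrite fl.2 => ->; rewrite rscale0l. Qed.
Definition ker_submod : submodule M :=
  Submodule (morphD0 fl.1) ker_submodD ker_submodZ.

Fact im_submodD x y :
  (exists z, f z = x) -> (exists z, f z = y) -> exists z, f z = x + y.
Proof. by case=> z <- [t <-]; exists (z + t); rewrite fl.1. Qed.
Fact im_submodZ x a : (exists z, f z = x) -> exists z, f z = x ** a.
Proof. by case=> z <-; exists (z ** a); rewrite fl.2. Qed.
Definition im_submod : submodule N :=
  Submodule (ex_intro _ 0 (morphD0 fl.1)) im_submodD im_submodZ.

End KernelImage.

Section SubmoduleType.
Variables (A : pzRingType) (M : rmodType A) (U : submodule M).

Lemma submodN x : U x -> U (- x).
Proof. by rewrite -rscaleN1; apply: submodZ. Qed.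

(** Membership is stored as a boolean, so that [submod] is a subtype and its elements are equal as
    soon as their values are. *)
Record submod := Submod {submod_val :> M; submod_valP : `[< U submod_val >]}.

HB.instance Definition _ := [isSub for submod_val].
HB.instance Definition _ := [Choice of submod by <:].

Implicit Types x y : submod.

Definition mk_submod (x : M) (Ux : U x) : submod := Submod (asboolT Ux).

Lemma submodP x : U x.
Proof. exact: asboolW (submod_valP x). Qed.

Definition sub_zero := mk_submod (submod0 U).
Definition sub_add x y := mk_submod (submodD (submodP x) (submodP y)).
Definition sub_opp x := mk_submod (submodN (submodP x)).
Definition sub_rscale x a := mk_submod (submodZ a (submodP x)).

Fact sub_addA : associative sub_add.
Proof. by move=> x y z; apply/val_inj/addrA. Qed.
Fact sub_addC : commutative sub_add.
Proof. by move=> x y; apply/val_inj/addrC. Qed.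
Fact sub_add0 : left_id sub_zero sub_add.
Proof. by move=> x; apply/val_inj/add0r. Qed.
Fact sub_addN : left_inverse sub_zero sub_opp sub_add.
Proof. by move=> x; apply/val_inj/addNr. Qed.

HB.instance Definition _ :=
  GRing.isZmodule.Build submod sub_addA sub_addC sub_add0 sub_addN.

Fact sub_rscaleA x a b : sub_rscale (sub_rscale x a) b = sub_rscale x (a * b).
Proof. exact/val_inj/rscaleA. Qed.
Fact sub_rscale1 x : sub_rscale x 1 = x.
Proof. exact/val_inj/rscale1. Qed.
Fact sub_rscaleDl x y a :
  sub_rscale (x + y) a = sub_rscale x a + sub_rscale y a.
Proof. exact/val_inj/rscaleDl. Qed.
Fact sub_rscaleDr x a b :
  sub_rscale x (a + b) = sub_rscale x a + sub_rscale x b.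
Proof. exact/val_inj/rscaleDr. Qed.

HB.instance Definition _ := Zmodule_isRmodule.Build A submod
  sub_rscaleA sub_rscale1 sub_rscaleDl sub_rscaleDr.

Lemma submod_val_rlinear : rlinear (submod_val : submod -> M).
Proof. by []. Qed.

Lemma submod_val_inj : injective (submod_val : submod -> M).
Proof. exact: val_inj. Qed.

End SubmoduleType.

(** * Quotient modules *)

Section Quotient.
Variables (A : pzRingType) (M : rmodType A) (U : submodule M).

Definition quot_rel : rel M := fun x y => `[< U (x - y) >].

Fact quot_rel_equiv : equiv_class_of quot_rel.
Proof.
split=> [x|x y|y x z].
- by apply/asboolP; rewrite subrr; apply: submod0.
- by apply/asboolP/asboolP=> /submodN; rewrite opprB.
- move=> /asboolP xy /asboolP yz; apply/asboolP.
  by rewrite -(subrKA y); apply: submodD.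
Qed.
Canonical quot_rel_equivRel := EquivRelPack quot_rel_equiv.

Definition quot := {eq_quot quot_rel}%qT.
HB.instance Definition _ := Choice.on quot.
HB.instance Definition _ := EqQuotient.on quot.

Implicit Types (u v w : quot) (x y : M).

Definition qproj x : quot := (\pi_quot x)%qT.

Lemma qprojP x y : qproj x = qproj y <-> U (x - y).
Proof. by split=> [/eqquotP/asboolP|xy] //; apply/eqquotP/asboolP. Qed.

Lemma qproj_repr u : qproj (repr u) = u.
Proof. exact: reprK. Qed.

Lemma repr_qproj x : U (repr (qproj x) - x).
Proof. by apply/qprojP; rewrite qproj_repr. Qed.

Definition quot_add u v := qproj (repr u + repr v).
Definition quot_opp u := qproj (- repr u).
Definition quot_rscale u a := qproj (repr u ** a).

Fact quot_addE x y : quot_add (qproj x) (qproj y) = qproj (x + y).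
Proof.
by apply/qprojP; rewrite opprD addrACA; apply: submodD; apply: repr_qproj.
Qed.

Fact quot_oppE x : quot_opp (qproj x) = qproj (- x).
Proof. by apply/qprojP; rewrite -opprD; apply/submodN/repr_qproj. Qed.

Fact quot_rscaleE x a : quot_rscale (qproj x) a = qproj (x ** a).
Proof.
apply/qprojP; rewrite -(morphDB (fun y z => rscaleDl y z a)).
exact/submodZ/repr_qproj.
Qed.

Fact quot_addA : associative quot_add.
Proof.
move=> u v w; rewrite -[u]qproj_repr -[v]qproj_repr -[w]qproj_repr.
by rewrite !quot_addE addrA.
Qed.
Fact quot_addC : commutative quot_add.
Proof. by move=> u v; rewrite /quot_add addrC. Qed.
Fact quot_add0 : left_id (qproj 0) quot_add.
Proof. by move=> u; rewrite -[u]qproj_repr quot_addE add0r. Qed.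
Fact quot_addN : left_inverse (qproj 0) quot_opp quot_add.
Proof.
by move=> u; rewrite -[u]qproj_repr quot_oppE quot_addE addNr.
Qed.

HB.instance Definition _ :=
  GRing.isZmodule.Build quot quot_addA quot_addC quot_add0 quot_addN.

Lemma qprojD : {morph qproj : x y / x + y}.
Proof. by move=> x y; rewrite -quot_addE. Qed.

Fact quot_rscaleA u a b : quot_rscale (quot_rscale u a) b = quot_rscale u (a * b).
Proof. by rewrite -[u]qproj_repr !quot_rscaleE rscaleA. Qed.
Fact quot_rscale1 u : quot_rscale u 1 = u.
Proof. by rewrite -[u]qproj_repr !quot_rscaleE rscale1. Qed.
Fact quot_rscaleDl u v a :
  quot_rscale (u + v) a = quot_rscale u a + quot_rscale v a.
Proof.
rewrite -[u]qproj_repr -[v]qproj_repr -qprojD !quot_rscaleE.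
by rewrite rscaleDl qprojD.
Qed.
Fact quot_rscaleDr u a b :
  quot_rscale u (a + b) = quot_rscale u a + quot_rscale u b.
Proof. by rewrite -[u]qproj_repr !quot_rscaleE rscaleDr qprojD. Qed.

HB.instance Definition _ := Zmodule_isRmodule.Build A quot
  quot_rscaleA quot_rscale1 quot_rscaleDl quot_rscaleDr.

Lemma qproj_rlinear : rlinear qproj.
Proof. by split=> [|x a]; [exact: qprojD | rewrite -quot_rscaleE]. Qed.

Lemma qproj_eq0 x : qproj x = 0 <-> U x.
Proof. by rewrite -[0]/(qproj 0) qprojP subr0. Qed.

Lemma qproj_surj u : exists x, qproj x = u.
Proof. by exists (repr u); apply: qproj_repr. Qed.

(** The map induced by [f] on the quotient is [f] after [repr]. The chosen representative differs
    from x by an element of U, which [f] kills. *)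
Lemma quot_lift_eq (V : zmodType) (f : M -> V) : {morph f : x y / x + y} ->
  (forall x, U x -> f x = 0) -> forall x, f (repr (qproj x)) = f x.
Proof.
move=> fD f0 x; apply/eqP; rewrite -subr_eq0 -(morphDB fD); apply/eqP/f0.
exact: repr_qproj.
Qed.

Lemma quot_lift_rlinear (N : rmodType A) (f : M -> N) : rlinear f ->
  (forall x, U x -> f x = 0) -> rlinear (fun u => f (repr u)).
Proof.
case=> fD fZ f0; have fE := quot_lift_eq fD f0.
have [qD qZ] := qproj_rlinear.
split=> [u v|u a].
  rewrite -[u in LHS]qproj_repr -[v in LHS]qproj_repr -qD fE; exact: fD.
by rewrite -[u in LHS]qproj_repr -qZ fE fZ.
Qed.

End Quotient.

(** * Exactness of the tensor product *)

Section TmapExactness.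
Variables (A : pzRingType).

Lemma tmap0 (M N : rmodType A) (C : lmodType A) (u : tensor M C) :
  tmap (fun _ : M => 0 : N) id u = 0.
Proof.
have zl : rlinear (fun _ : M => 0 : N) by split=> [x y|x a]; rewrite ?addr0 ?rscale0l.
move: u; apply: (tensor_ext (g := fun=> 0)) => [u v|u v|x y].
- exact: (tmapD zl (@linear_id _ C)).
- by rewrite addr0.
by rewrite (tmap_tens zl (@linear_id _ C)) tens0l.
Qed.

(* Right exactness of the tensor product: a representative x of u in M / U is *)
(* unique up to U, so (u, c) |-> x ⊗ c is balanced modulo the image of U ⊗ C. *)
Lemma tmap_qproj_ker (M : rmodType A) (U : submodule M) (C : bimodType A A)
    (u : tensor M C) :
  tmap (@qproj A M U) id u = 0 ->
  exists v : tensor (submod U) C, tmap (@submod_val A M U) id v = u.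
Proof.
have idl := @linear_id A C; have ql := qproj_rlinear U.
have il := submod_val_rlinear U.
pose W := im_submod (tmap_rlinear il (id_bimodule_linear C)).
pose g (y : quot U) (c : C) : quot W := qproj W (repr y ⊗ c).
have gE x c : g (qproj U x) c = qproj W (x ⊗ c).
  apply/(@qprojP _ _ W).
  rewrite -(morphDB (fun x x' : M => tensDl x x' c)).
  exists (mk_submod (repr_qproj U x) ⊗ c); by rewrite tmap_tens.
have gb : balanced g.
  split=> [y y' c|y c c'|y a c].
  - rewrite -[y]qproj_repr -[y']qproj_repr -(ql.1) !gE -qprojD.
    by rewrite tensDl.
  - by rewrite /g tensDr qprojD.
  - by rewrite -[y]qproj_repr -ql.2 !gE tens_bal.
have E w : tlift g (tmap (@qproj A M U) id w) = qproj W w.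
  move: w; apply: tensor_ext => [w w'|w w'|x c].
  - by rewrite tmapD // tliftD.
  - exact: qprojD.
  by rewrite tmap_tens // tlift_tens.
by move=> u0; apply/(qproj_eq0 W); rewrite -E u0 tlift0.
Qed.

(** The induced map M / ker f -> N is injective, hence by flatness remains so after tensoring with
    C. Thus u already vanishes in (M / ker f) ⊗ C, and right exactness ([tmap_qproj_ker])
    applies. *)
Lemma tmap_ker (M N : rmodType A) (C : bimodType A A) (f : M -> N)
    (fl : rlinear f) : lflat C -> forall u : tensor M C, tmap f id u = 0 ->
  exists v : tensor (submod (ker_submod fl)) C,
    tmap (@submod_val A M (ker_submod fl)) id v = u.
Proof.
move=> Cflat u fu0; apply: tmap_qproj_ker; set U := ker_submod fl.
have idl := @linear_id A C; have ql := qproj_rlinear U.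
have f0 x : U x -> f x = 0 by [].
have gl := quot_lift_rlinear fl f0; have gE := quot_lift_eq fl.1 f0.
apply: (Cflat _ _ _ gl) => [y z|].
  rewrite -[y]qproj_repr -[z]qproj_repr !gE => fyz.
  apply/qprojP; rewrite /U /= (morphDB fl.1) fyz; exact: subrr.
rewrite (tmap_comp gl ql idl idl) (tmap_eq gE (frefl _)) fu0.
exact/esym/morphD0/(tmapD gl idl).
Qed.

End TmapExactness.

(** * Inverse of the associator, and flatness of tensor products *)

Section AssociatorInverse.
Variables (A B : pzRingType) (M : rmodType A) (N : bimodType A B).
Variable P : lmodType B.

Definition tassoc_inv : tensor M (tensor N P) -> tensor (tensor M N) P :=
  tlift (fun x u => tlift (fun y z => (x ⊗ y : tensor M N) ⊗ z) u).

Lemma tassoc_inv_balanced1 (x : M) :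
  balanced (fun (y : N) (z : P) => (x ⊗ y : tensor M N) ⊗ z).
Proof.
split=> [y y' z|y z z'|y b z]; rewrite ?tensDr ?tensDl //.
by rewrite -rscale_tens tens_bal.
Qed.

Lemma tassoc_inv_balanced2 :
  balanced (fun (x : M) (u : tensor N P) =>
              tlift (fun y z => (x ⊗ y : tensor M N) ⊗ z) u).
Proof.
split=> [x x' u|x u v|x a u].
- move: u; apply: tensor_ext => [u v|u v|y z].
  + exact: tliftD (tassoc_inv_balanced1 _).
  + by rewrite !(tliftD _ _ (tassoc_inv_balanced1 _)) addrACA.
  by rewrite !(tlift_tens _ _ (tassoc_inv_balanced1 _)) !tensDl.
- exact: tliftD (tassoc_inv_balanced1 x).
- move: u; apply: tensor_ext => [u v|u v|y z].
  + exact: tliftD (tassoc_inv_balanced1 _).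
  + by rewrite scalerDr (tliftD _ _ (tassoc_inv_balanced1 _)).
  by rewrite scale_tens !(tlift_tens _ _ (tassoc_inv_balanced1 _)) tens_bal.
Qed.

Lemma tassoc_inv_tens x y z : tassoc_inv (x ⊗ (y ⊗ z)) = (x ⊗ y) ⊗ z.
Proof.
by rewrite /tassoc_inv (tlift_tens _ _ tassoc_inv_balanced2)
  (tlift_tens _ _ (tassoc_inv_balanced1 _)).
Qed.

Lemma tassoc_invD : {morph tassoc_inv : u v / u + v}.
Proof. by move=> u v; apply: tliftD tassoc_inv_balanced2. Qed.

Lemma tassocK : cancel (@tassoc A B M N P) tassoc_inv.
Proof.
apply: (tensor_ext (g := id)) => [u v|//|u z].
  by rewrite tassocD tassoc_invD.
move: u; apply: tensor_ext => [u v|u v|x y].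
- by rewrite tensDl tassocD tassoc_invD.
- exact: tensDl.
by rewrite tassoc_tens tassoc_inv_tens.
Qed.

Lemma tassoc_invK : cancel tassoc_inv (@tassoc A B M N P).
Proof.
apply: (tensor_ext (g := id)) => [u v|//|x u].
  by rewrite tassoc_invD tassocD.
move: u; apply: tensor_ext => [u v|u v|y z].
- by rewrite tensDr tassoc_invD tassocD.
- exact: tensDr.
by rewrite tassoc_inv_tens tassoc_tens.
Qed.

End AssociatorInverse.

(** Up to the associator, which is natural and bijective, tensoring with C ⊗ D is tensoring with C
    and then with D. *)
Lemma lflat_tensor (A B : pzRingType) (C : bimodType A B) (D : lmodType B) :
  lflat C -> lflat D -> lflat (tensor C D).
Proof.
move=> Cflat Dflat M N f fl fi u v; have idb := id_bimodule_linear C.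
rewrite -[u]tassoc_invK -[v]tassoc_invK -!(tassoc_tmap fl).
move=> /(can_inj (@tassocK _ _ _ _ _)) /(Dflat _ _ _ (tmap_rlinear fl idb)).
by move=> /(_ (Cflat _ _ _ fl fi)) ->.
Qed.

(** * Kernels of comodule maps *)

Section KernelComodule.
Variables (A : pzRingType) (C : coring A) (C_flat : lflat C).
Variables (M N : comodule C) (f : comod_hom M N).

Let K := ker_submod (comod_hom_rlinear f).
Let i : submod K -> M := @submod_val A M K.
Let il : rlinear i := submod_val_rlinear K.
Let idl := @linear_id A C.
Let idb := id_bimodule_linear C.
Let i_inj : injective (tmap i id : tensor (submod K) C -> tensor M C) :=
  C_flat il (@submod_val_inj A M K).

Fact ker_coact_subproof (x : submod K) :
  exists v : tensor (submod K) C, tmap i id v = coact (i x).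
Proof.
apply: tmap_ker => //; rewrite -comod_hom_coact (submodP x).
exact: morphD0 (coact_rlinear N).1.
Qed.

(** The preimage picked by [cid] is unique because [tmap i id] is injective by flatness; this is
    what makes the choice linear. *)
Definition ker_coact x := projT1 (cid (ker_coact_subproof x)).

Lemma ker_coactE x : tmap i id (ker_coact x) = coact (i x).
Proof. by rewrite /ker_coact; case: cid. Qed.

Fact ker_coact_rlinear : rlinear ker_coact.
Proof.
have [tD tZ] := tmap_rlinear il idb; have [cD cZ] := coact_rlinear M.
split=> [x y|x a]; apply: i_inj; first by rewrite tD !ker_coactE -cD.
by rewrite tZ !ker_coactE -cZ.
Qed.

Fact ker_coactA x : tassoc (tmap ker_coact id (ker_coact x))
  = tmap id (@comul A C) (ker_coact x).
Proof.
have kl := ker_coact_rlinear; have Cl := (comul_bimodule_linear C).1.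
have idm (L : rmodType A) := @rlinear_id _ L.
have ml := coact_rlinear M; have til := tmap_rlinear il idb.
(* C ⊗ C is flat, so both sides may be compared in M ⊗ (C ⊗ C), where the identity becomes
   coassociativity of M. *)
apply: (lflat_tensor C_flat C_flat il (@submod_val_inj A M K)).
rewrite -(tassoc_tmap il) (tmap_comp til kl idl idl).
rewrite (tmap_eq ker_coactE (frefl _)) -(tmap_comp ml il idl idl) ker_coactE.
rewrite coactA (tmap_comp il (idm _) (@linear_id _ _) Cl) -ker_coactE.
by rewrite (tmap_comp (idm _) il Cl idl).
Qed.

Fact ker_coact_counit x : tlift (fun y c => y ** counit c) (ker_coact x) = x.
Proof.
have rb := @rscale_counit_balanced A C.
apply: (@submod_val_inj A M K); rewrite -[RHS]/(i x) -[RHS]coact_counit.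
rewrite -ker_coactE; move: (ker_coact x).
apply: tensor_ext => [u v|u v|y c].
- by rewrite (tliftD _ _ (rb _)).
- by rewrite (tmapD il idl) (tliftD _ _ (rb _)).
by rewrite (tmap_tens il idl) !(tlift_tens _ _ (rb _)).
Qed.

Definition ker_comod : comodule C :=
  Comodule ker_coact_rlinear ker_coactA ker_coact_counit.

Definition ker_incl : comod_hom ker_comod M :=
  @ComodHom A C ker_comod M i il (fun x => esym (ker_coactE x)).

Lemma ker_incl_inj : injective ker_incl.
Proof. exact: (@submod_val_inj A M K). Qed.

Lemma ker_inclP x : f (ker_incl x) = 0.
Proof. exact: submodP x. Qed.

Lemma ker_incl_onto x : f x = 0 -> exists y, ker_incl y = x.
Proof. by move=> fx0; exists (@mk_submod A M K x fx0). Qed.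

End KernelComodule.

(** * Cokernels of comodule maps, and epimorphisms *)

Section CokernelComodule.
Variables (A : pzRingType) (C : coring A) (M N : comodule C).
Variable f : comod_hom M N.

Let fl := comod_hom_rlinear f.
Let W := im_submod fl.
Let q : N -> quot W := @qproj A N W.
Let ql : rlinear q := qproj_rlinear W.
Let idl := @linear_id A C.
Let idb := id_bimodule_linear C.
Let qcl := rlinear_comp (tmap_rlinear ql idb) (coact_rlinear N).

(** Makes the coaction descend to N / im f: the coaction of f x comes from (f ⊗ id), and q f = 0. *)
Let qc0 y : W y -> tmap q id (coact y) = 0.
Proof.
case=> x <-; rewrite comod_hom_coact (tmap_comp ql fl idl idl).
have qf0 z : q (f z) = 0 by apply/qproj_eq0; exists z.
by rewrite (tmap_eq qf0 (frefl _)) tmap0.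
Qed.

Definition coker_coact (u : quot W) : tensor (quot W) C :=
  tmap q id (coact (repr u)).

Lemma coker_coactE y : coker_coact (q y) = tmap q id (coact y).
Proof. exact: (quot_lift_eq qcl.1 qc0). Qed.

Fact coker_coact_rlinear : rlinear coker_coact.
Proof. exact: (quot_lift_rlinear qcl qc0). Qed.

Fact coker_coactA u : tassoc (tmap coker_coact id (coker_coact u))
  = tmap id (@comul A C) (coker_coact u).
Proof.
have Cl := (comul_bimodule_linear C).1.
have idm (L : rmodType A) := @rlinear_id _ L.
have [y <-] := qproj_surj u; rewrite -/(q y) coker_coactE.
rewrite (tmap_comp coker_coact_rlinear ql idl idl).
rewrite (tmap_eq coker_coactE (frefl _)).
rewrite -(tmap_comp (tmap_rlinear ql idb) (coact_rlinear N) idl idl).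
rewrite (tassoc_tmap ql) coactA (tmap_comp ql (idm _) (@linear_id _ _) Cl).
by rewrite (tmap_comp (idm _) ql Cl idl).
Qed.

Fact coker_coact_counit u : tlift (fun y c => y ** counit c) (coker_coact u) = u.
Proof.
have rb := @rscale_counit_balanced A C.
have [y <-] := qproj_surj u; rewrite -/(q y) coker_coactE.
rewrite -[y in RHS]coact_counit; move: (coact y).
apply: tensor_ext => [v w|v w|z c].
- by rewrite (tmapD ql idl) (tliftD _ _ (rb _)).
- by rewrite (tliftD _ _ (rb _)) ql.1.
by rewrite (tmap_tens ql idl) !(tlift_tens _ _ (rb _)) ql.2.
Qed.

Definition coker_comod : comodule C :=
  Comodule coker_coact_rlinear coker_coactA coker_coact_counit.

Definition coker_proj : comod_hom N coker_comod :=
  @ComodHom A C N coker_comod q ql coker_coactE.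

End CokernelComodule.

Section ZeroHom.
Variables (A : pzRingType) (C : coring A) (M N : comodule C).

Fact comod_zero_rlinear : rlinear (fun _ : M => 0 : N).
Proof. by split=> [x y|x a]; rewrite ?addr0 ?rscale0l. Qed.

Fact comod_zero_coact (x : M) :
  coact (0 : N) = tmap (fun _ : M => 0 : N) id (coact x).
Proof. by rewrite tmap0; apply: morphD0 (coact_rlinear N).1. Qed.

Definition comod_zero : comod_hom M N :=
  ComodHom comod_zero_rlinear comod_zero_coact.

End ZeroHom.

(** The projection to the cokernel and the zero map agree after [f], hence are equal, so every y
    lies in the image. *)
Lemma epimorphism_surjective (A : pzRingType) (C : coring A) (M N : comodule C)
  (f : comod_hom M N) : epimorphism f -> surjective f.
Proof.
move=> f_epi y; apply/(@qproj_eq0 A N (im_submod (comod_hom_rlinear f))).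
apply: (f_epi _ (coker_proj f) (comod_zero N (coker_comod f))) => x.
by apply/qproj_eq0; exists x.
Qed.

(** * Composition, and comodule maps on direct sums *)

Lemma comod_comp_coact (A : pzRingType) (C : coring A) (M N P : comodule C)
    (g : comod_hom N P) (f : comod_hom M N) x :
  coact (g (f x)) = tmap (fun x => g (f x)) id (coact x).
Proof.
have idl := @linear_id A C.
rewrite !comod_hom_coact.
by rewrite (tmap_comp (comod_hom_rlinear g) (comod_hom_rlinear f) idl idl).
Qed.

Definition comod_comp (A : pzRingType) (C : coring A) (M N P : comodule C)
    (g : comod_hom N P) (f : comod_hom M N) : comod_hom M P :=
  ComodHom (rlinear_comp (comod_hom_rlinear g) (comod_hom_rlinear f))
    (comod_comp_coact g f).

Section DirectSumHom.
Variables (A : pzRingType) (C : coring A) (I : choiceType) (M N : comodule C).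

Definition dsum_inj (i : I) : comod_hom M (dsum I M) :=
  @ComodHom A C M (dsum I M) (dsum_in i) (dsum_in_rlinear M i)
    (dsum_coact_in (M := M) i).

Variable h : I -> comod_hom M N.

Let hD i : {morph h i : x y / x + y} := (comod_hom_rlinear (h i)).1.

Fact dsum_copair_rlinear : rlinear (dsum_lift h : dsum I M -> N).
Proof.
split=> [|x a]; first exact: dsum_liftD hD.
move: x; apply: dsum_ext => [x y|x y|i x].
- by rewrite rscaleDl (dsum_liftD hD).
- by rewrite (dsum_liftD hD) rscaleDl.
rewrite -(dsum_in_rlinear M i).2 !(dsum_lift_in hD).
exact: (comod_hom_rlinear (h i)).2.
Qed.

Fact dsum_copair_coact (x : dsum I M) :
  coact (dsum_lift h x) = tmap (dsum_lift h : dsum I M -> N) id (coact x).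
Proof.
have idl := @linear_id A C; have dl := dsum_copair_rlinear.
move: x; apply: dsum_ext => [x y|x y|i x].
- by rewrite (dsum_liftD hD) (coact_rlinear N).1.
- by rewrite (coact_rlinear (dsum I M)).1 (tmapD dl idl).
rewrite (dsum_lift_in hD) [X in _ = tmap _ _ X](comod_hom_coact (dsum_inj i)).
rewrite (tmap_comp dl (dsum_in_rlinear M i) idl idl) comod_hom_coact.
by apply: tmap_eq => // y; rewrite (dsum_lift_in hD).
Qed.

Definition dsum_copair : comod_hom (dsum I M) N :=
  ComodHom dsum_copair_rlinear dsum_copair_coact.

Lemma dsum_copair_in i x : dsum_copair (dsum_in i x) = h i x.
Proof. exact: dsum_lift_in hD i x. Qed.

End DirectSumHom.

Section Projection.
Variables (A : pzRingType) (C : coring A) (I : choiceType) (M : comodule C).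

(** Building the coordinate function as a copairing makes it a comodule map, so that composites with
    it from S to S lie in T. *)
Definition dsum_proj (i : I) : comod_hom (dsum I M) M :=
  dsum_copair (fun j => if j == i then endo_one M else comod_zero M M).

Lemma dsum_projE i (x : dsum I M) : dsum_proj i x = x@_i.
Proof.
move: x; apply: dsum_ext => [x y|x y|j x].
- exact: (comod_hom_rlinear (dsum_proj i)).1.
- exact: mcoeffD.
by rewrite dsum_copair_in dsum_inE; case: eqP.
Qed.

End Projection.

(** * Functionals on M as comodule maps from M to C *)

Section DualHom.
Variables (A : pzRingType) (C : coring A).

Definition regular_comod : comodule C :=
  @Comodule A C C (@comul A C) (comul_bimodule_linear C).2 (@comulA A C)
    (@counitr A C).

Variables (M : comodule C) (f : dual M).

Fact dual_hom_rlinear : rlinear (fun x : M => contract f (coact x) : C).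
Proof. exact: rlinear_comp (contract_rlinear f C) (coact_rlinear M). Qed.

(** Contraction with [f] touches only the factor M, so it commutes with comultiplication on C;
    coassociativity of M does the rest. *)
Fact dual_hom_coact x : comul (contract f (coact x))
  = tmap (fun x : M => contract f (coact x)) id (coact x).
Proof.
have [[Cl [CD _]] idl] := (comul_bimodule_linear C, @linear_id A C).
have [_ CZ] := linearDZ Cl; have fl := contract_rlinear f C.
rewrite -(tmap_comp fl (coact_rlinear M) idl idl).
transitivity (contract f (tmap id (@comul A C) (coact x))).
  move: (coact x); apply: tensor_ext => [u v|u v|y c].
  - by rewrite contractD CD.
  - by rewrite (tmapD (@rlinear_id _ _) Cl) contractD.
  by rewrite (tmap_tens (@rlinear_id _ _) Cl) !contract_tens CZ.
rewrite -coactA; move: (tmap _ _ _); apply: tensor_ext => [u v|u v|u c].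
- by rewrite tassocD contractD.
- exact: tmapD.
rewrite tmap_tens //; move: u; apply: tensor_ext => [u v|u v|y d].
- by rewrite tensDl tassocD contractD.
- by rewrite contractD tensDl.
by rewrite tassoc_tens !contract_tens scale_tens.
Qed.

Definition dual_hom : comod_hom M regular_comod :=
  @ComodHom A C M regular_comod _ dual_hom_rlinear dual_hom_coact.

(** Shows that passing from functionals to comodule maps loses nothing; it turns relations among the
    maps back into relations among the functionals. *)
Lemma counit_dual_hom x : counit (dual_hom x : C) = f x.
Proof.
have [cl [cD _]] := counit_bimodule_linear C; have [_ cZ] := linearDZ cl.
have rb := @rscale_counit_balanced A C M.
rewrite -[x in RHS]coact_counit /=.
move: (coact x); apply: tensor_ext => [u v|u v|y c].
- by rewrite contractD cD.
- by rewrite (tliftD _ _ rb) dualD.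
by rewrite contract_tens (tlift_tens _ _ rb) dualZ cZ.
Qed.

End DualHom.

(** * Injectivity of the canonical map *)

Lemma tensor_repr_ord (A : pzRingType) (M : rmodType A) (N : lmodType A)
    (u : tensor M N) :
  exists (n : nat) (x : 'I_n -> M) (y : 'I_n -> N), u = \sum_i (x i ⊗ y i).
Proof.
pose s := repr u; pose p (i : 'I_(size s)) := nth (0, 0) s i.
exists (size s), (fun i => (p i).1), (fun i => (p i).2).
by rewrite [LHS]tensorE (big_nth (0, 0)) big_mkord.
Qed.

Lemma can_injective (A : pzRingType) (C : coring A) (S : comodule C) :
    lflat C ->
    (forall (n : nat) (N : comodule C),
      subcomodule N (dsum 'I_n S) -> generates S N) ->
  injective (@can A C S).
Proof.
move=> C_flat S_gen.
suff can_ker u : can u = 0 -> u = 0 :> comatrix S.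
  move=> u v uv; apply/eqP; rewrite -subr_eq0; apply/eqP/can_ker.
  by rewrite (morphDB (@canD A C S)) uv subrr.
(* Indexing by ['I_n] turns the x_i into a vector of [dsum 'I_n S]. *)
have [n [f [x ->]]] := tensor_repr_ord u.
pose F := dsum_copair (fun i => dual_hom (f i)).
have FE z : F z = \sum_i dual_hom (f i) z@_i :> C.
  move: z; apply: dsum_ext => [y z|y z|i y].
  - exact: (comod_hom_rlinear F).1.
  - rewrite -big_split; apply: eq_bigr => i _.
    by rewrite mcoeffD (comod_hom_rlinear (dual_hom (f i))).1.
  rewrite dsum_copair_in (bigD1 i) //= big1 => [|j ji].
    by rewrite dsum_inE eqxx addr0.
  rewrite dsum_inE eq_sym (negPf ji).
  exact: morphD0 (comod_hom_rlinear (dual_hom (f j))).1.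
(* [Phi] takes the given tensor as its value at X; the aim is that it vanishes on the kernel of
   [F]. *)
pose Phi (z : dsum 'I_n S) : comatrix S := \sum_i (f i ⊗ (z@_i : lendo S)).
have PhiD : {morph Phi : y z / y + z}.
  move=> y z; rewrite -big_split; apply: eq_bigr => i _.
  by rewrite mcoeffD tensDr.
pose X : dsum 'I_n S := \sum_i dsum_in i (x i : S).
have XE i : X@_i = x i.
  rewrite (big_morph _ (fun g h => mcoeffD i g h) (mcoeff0 _)) (bigD1 i) //=.
  rewrite big1 => [|j ji]; last by rewrite dsum_inE (negPf ji).
  by rewrite dsum_inE eqxx addr0.
rewrite (big_morph _ (@canD A C S) (morphD0 (@canD A C S))) => u0.
have /ker_incl_onto-/(_ C_flat)[k kX] : F X = 0.
  by rewrite FE -[RHS]u0; apply: eq_bigr => i _; rewrite can_tens XE.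
have /S_gen[I [p p_epi]] : subcomodule (ker_comod C_flat F) (dsum 'I_n S).
  by exists (ker_incl C_flat F); apply: ker_incl_inj.
have [w wk] := epimorphism_surjective p_epi k.
have <- : Phi X = \sum_i (f i ⊗ x i) by apply: eq_bigr => i _; rewrite XE.
rewrite -kX -wk; pose G := comod_comp (ker_incl C_flat F) p.
(* The vector X is now G w. Since F G = 0, the claim can be proved for every w; it is additive in w,
   so elements of single summands suffice. *)
rewrite -[ker_incl _ _ _]/(G w); move: w {wk}.
have GD := (comod_hom_rlinear G).1.
apply: (dsum_ext (g := fun=> 0)) => [y z|y z|j y].
- by rewrite GD PhiD.
- by rewrite addr0.
(* The column over T that describes G on the j-th summand. *)
pose g i : endo S := comod_comp (dsum_proj S i) (comod_comp G (dsum_inj S j)).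
have gE i z : g i z = (G (dsum_in j z))@_i by rewrite -dsum_projE.
(* Apply the counit to F G = 0 on the j-th summand. *)
have fg0 : \sum_i f i ** g i = 0 :> dual S.
  apply/dualP => z.
  rewrite (big_morph (fun e : dual S => e z) (fun _ _ => erefl) erefl).
  have cD := (counit_bimodule_linear C).2.1.
  transitivity (counit (F (G (dsum_in j z)) : C)); last first.
    by rewrite ker_inclP; apply: (morphD0 cD).
  rewrite FE (big_morph _ cD (morphD0 cD)); apply: eq_bigr => i _.
  by rewrite counit_dual_hom -gE.
(* Balancing over T moves the g_i from y to the functionals. *)
rewrite /Phi; transitivity ((\sum_i f i ** g i) ⊗ (y : lendo S)).
  rewrite tens_suml; apply: eq_bigr => i _; rewrite tens_bal.
  by congr tens; rewrite -gE.
by rewrite fg0 tens0l.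
Qed.

Theorem corollary1p6 (K : comPzRingType) (A : pzRingType)
    (iota : {rmorphism K -> A})
    (iota_central : forall (k : K) (a : A), iota k * a = a * iota k)
    (C : coring A)
    (C_centralized : forall (k : K) (c : C), iota k *: c = c ** iota k)
    (C_flat : lflat C)
    (S : comodule C)
    (S_fg : finitely_generated S)
    (S_projective : projective S)
    (S_quasi_projective : quasi_projective S)
    (S_generates : forall (n : nat) (N : comodule C),
      subcomodule N (dsum 'I_n S) -> generates S N)
    (can_surjective : surjective (@can A C S)) :
  galois S.
Proof.
have inj := can_injective C_flat S_generates.
(* A section of [can] obtained by choice is a two-sided inverse once [can] is injective. *)
have [g gK] := choice can_surjective.
by exists g => // u; apply: inj; rewrite gK.
Qed.
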